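(* Let $M$ and $M'$ be Coxeter matrices of Weyl type over finite sets $I$ and $I'$, and let $\phi:(W(M'),\star)\to(W(M),\star)$ be a light homomorphism of Hecke monoids. Then for any Cartan matrix $A$ over $I$ such that $M=\mathsf C(A)$ there exists a Cartan matrix $A'$ over $I'$ such that $M'=\mathsf C(A')$ and the assignments $$ e_{i'}\mapsto \begin{cases} e_i,& [\phi](i')=\{i\}\neq\emptyset,\\ 0,& [\phi](i')=\emptyset,\end{cases}\qquad i'\in I', $$ define a homomorphism of Lie algebras $\widehat{[\phi]}:\mathfrak n(A')\to\mathfrak n(A)$.
   Context: A Coxeter matrix over a finite set $I$ is a symmetric matrix $M=(m_{ij})_{i,j\in I}$ with $m_{ii}=1$ and $m_{ij}\in\mathbb Z_{\ge 2}\cup\{\infty\}$ for $i\ne j$. It is of Weyl type if $m_{ij}\in\{2,3,4,6,\infty\}$ for all $i\ne j$. The Hecke monoid $(W(M),\star)$ is the monoid generated by $s_i$, $i\in I$, subject to $s_i\star s_i=s_i$ and $s_i\star s_j\star\cdots=s_j\star s_i\star\cdots$ ($m_{ij}$ factors on each side) for $i\ne j$ with $m_{ij}<\infty$; its underlying set is identified with the Coxeter group $W(M)$ (a reduced word being sent to the $\star$-product of its letters). The support $\operatorname{supp}w$ of an element $w$ is the set of $i\in I$ such that $s_i$ occurs in a reduced expression of $w$. Generators for $M'$ are denoted $s'_{i'}$, $i'\in I'$. For a homomorphism of Hecke monoids $\phi$ (mapping $1$ to $1$) put $[\phi](i')=\operatorname{supp}\phi(s'_{i'})$. $\phi$ is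 light if $|[\phi](i')|\le 1$ for all $i'\in I'$, i.e. each generator is mapped to a generator or to $1$. A (generalized) Cartan matrix over a finite set $I$ is an integer matrix $A=(a_{i,j})_{i,j\in I}$ with $a_{i,i}=2$, $a_{i,j}\le 0$ for $i\ne j$, and $a_{i,j}=0$ implies $a_{j,i}=0$. The Lie algebra $\mathfrak n(A)$ (over a fixed ground field) is generated by $e_i$, $i\in I$, subject to the Serre relations $(\operatorname{ad}e_i)^{1-a_{i,j}}(e_j)=0$ for $i\neq j\in I$. The Coxeter matrix $\mathsf C(A)$ of Weyl type over $I$ is defined by $\mathsf C(A)_{i,i}=1$ and, for $i\ne j$: $\mathsf C(A)_{i,j}=2+a_{i,j}a_{j,i}$ if $a_{i,j}a_{j,i}\le 1$; $\mathsf C(A)_{i,j}=2a_{i,j}a_{j,i}$ if $a_{i,j}a_{j,i}\in\{2,3\}$; $\mathsf C(A)_{i,j}=\infty$ if $a_{i,j}a_{j,i}>3$. *)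

(* Defs.v *)
From HB Require Import structures.
From mathcomp Require Import all_boot all_order all_algebra.
From mathcomp Require Import boolp.

Set Implicit Arguments.
Unset Strict Implicit.
Unset Printing Implicit Defensive.

Import GRing.Theory.
Local Open Scope quotient_scope.

Section PresentedMonoid.
Variables (I : choiceType) (R : seq I -> seq I -> Prop).

Inductive word_cong : seq I -> seq I -> Prop :=
| wc_refl u : word_cong u u
| wc_sym u v : word_cong u v -> word_cong v u
| wc_trans u v w : word_cong u v -> word_cong v w -> word_cong u w
| wc_rel p u v q : R u v -> word_cong (p ++ u ++ q) (p ++ v ++ q).

Definition word_equiv : rel (seq I) := fun u v => `[< word_cong u v >].

Lemma word_equiv_refl : reflexive word_equiv.
Proof. by move=> u; apply/asboolP/wc_refl. Qed.

Lemma word_equiv_sym : symmetric word_equiv.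
Proof. by move=> u v; apply/asboolP/asboolP => /wc_sym. Qed.

Lemma word_equiv_trans : transitive word_equiv.
Proof.
move=> v u w /asboolP uv /asboolP vw.
by apply/asboolP/(wc_trans uv vw).
Qed.

Canonical word_equiv_rel :=
  EquivRel word_equiv word_equiv_refl word_equiv_sym word_equiv_trans.

Definition pres_monoid : Type := {eq_quot word_equiv}.
HB.instance Definition _ := Choice.on pres_monoid.
HB.instance Definition _ := EqQuotient.on pres_monoid.

Definition pres_word (u : seq I) : pres_monoid := \pi_pres_monoid u.

Lemma pres_wordP (u v : seq I) : pres_word u = pres_word v <-> word_cong u v.
Proof. by split => [/eqmodP/asboolP|uv]; [|apply/eqmodP/asboolP]. Qed.

Lemma repr_pres_word (x : pres_monoid) : pres_word (repr x) = x.
Proof. exact: reprK. Qed.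

Lemma word_cong_cat u u' v v' :
  word_cong u u' -> word_cong v v' -> word_cong (u ++ v) (u' ++ v').
Proof.
have ctx p q x y : word_cong x y -> word_cong (p ++ x ++ q) (p ++ y ++ q).
  elim=> [a|a b _ IH|a b c _ IH1 _ IH2|p' a b q' Rab].
  - exact: wc_refl.
  - exact: wc_sym.
  - exact: wc_trans IH1 IH2.
  - by have := wc_rel (p ++ p') (q' ++ q) Rab; rewrite -!catA.
move=> uu' vv'.
apply: (@wc_trans _ (u' ++ v)); first exact: (ctx [::] v).
by have := ctx u' [::] _ _ vv'; rewrite !cats0.
Qed.

Definition pres_mul (x y : pres_monoid) : pres_monoid :=
  pres_word (repr x ++ repr y).

Lemma pres_word_cat u v :
  pres_word (u ++ v) = pres_mul (pres_word u) (pres_word v).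
Proof.
by apply/pres_wordP/word_cong_cat; apply/pres_wordP; rewrite repr_pres_word.
Qed.

Lemma pres_mulA : associative pres_mul.
Proof.
move=> x y z.
by rewrite -(repr_pres_word x) -(repr_pres_word y) -(repr_pres_word z)
           -!pres_word_cat catA.
Qed.

Lemma pres_mul1 : left_id (pres_word [::]) pres_mul.
Proof. by move=> x; rewrite -(repr_pres_word x) -pres_word_cat. Qed.

Lemma pres_mulr1 : right_id (pres_word [::]) pres_mul.
Proof. by move=> x; rewrite -(repr_pres_word x) -pres_word_cat cats0. Qed.

HB.instance Definition _ :=
  isMonoid.Build pres_monoid pres_mulA pres_mul1 pres_mulr1.

End PresentedMonoid.

(* An entry [None] stands for infinity. *)
Definition is_coxeter_matrix (I : finType) (M : I -> I -> option nat) : Prop :=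
  [/\ forall i j, M i j = M j i,
      forall i, M i i = Some 1
    & forall i j m, i != j -> M i j = Some m -> 2 <= m].

Definition weyl_type (I : finType) (M : I -> I -> option nat) : Prop :=
  forall i j, i != j ->
    M i j \in [:: Some 2; Some 3; Some 4; Some 6; None].

(* The word i j i j ... with m letters. *)
Definition alt_word (I : Type) (i j : I) (m : nat) : seq I :=
  mkseq (fun k => if odd k then j else i) m.

Inductive coxeter_rel (I : finType) (M : I -> I -> option nat) :
    seq I -> seq I -> Prop :=
| cox_invol i : coxeter_rel M [:: i; i] [::]
| cox_braid i j m : i != j -> M i j = Some m ->
    coxeter_rel M (alt_word i j m) (alt_word j i m).

(* The generators being involutions, this monoid presentation presents the
   Coxeter group W(M). *)
Definition coxeter_group (I : finType) (M : I -> I -> option nat) :=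
  pres_monoid (coxeter_rel M).
HB.instance Definition _ (I : finType) (M : I -> I -> option nat) :=
  Monoid.on (coxeter_group M).

Definition coxeter_word (I : finType) (M : I -> I -> option nat) (u : seq I) :
  coxeter_group M := pres_word (coxeter_rel M) u.

Definition reduced (I : finType) (M : I -> I -> option nat) (u : seq I) : Prop :=
  forall v, coxeter_word M v = coxeter_word M u -> size u <= size v.

Inductive hecke_rel (I : finType) (M : I -> I -> option nat) :
    seq I -> seq I -> Prop :=
| hecke_idem i : hecke_rel M [:: i; i] [:: i]
| hecke_braid i j m : i != j -> M i j = Some m ->
    hecke_rel M (alt_word i j m) (alt_word j i m).

Definition hecke_monoid (I : finType) (M : I -> I -> option nat) :=
  pres_monoid (hecke_rel M).
HB.instance Definition _ (I : finType) (M : I -> I -> option nat) :=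
  Monoid.on (hecke_monoid M).

Definition hecke_word (I : finType) (M : I -> I -> option nat) (u : seq I) :
  hecke_monoid M := pres_word (hecke_rel M) u.

Definition hecke_gen (I : finType) (M : I -> I -> option nat) (i : I) :
  hecke_monoid M := hecke_word M [:: i].

(* A reduced word u of the Coxeter group is sent to the Hecke product
   [hecke_word M u] of its letters; under this identification of W(M) with the
   Hecke monoid, u is a reduced expression of [hecke_word M u]. *)
Definition supp (I : finType) (M : I -> I -> option nat) (w : hecke_monoid M) :
    {set I} :=
  [set i | `[< exists u, [/\ reduced M u, hecke_word M u = w & i \in u] >]].

Definition gen_supp (I I' : finType) (M : I -> I -> option nat)
    (M' : I' -> I' -> option nat) (phi : hecke_monoid M' -> hecke_monoid M)
    (i' : I') : {set I} :=
  supp (phi (hecke_gen M' i')).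

Definition light (I I' : finType) (M : I -> I -> option nat)
    (M' : I' -> I' -> option nat) (phi : hecke_monoid M' -> hecke_monoid M) :
    Prop :=
  forall i', #|gen_supp phi i'| <= 1.

Local Open Scope ring_scope.

HB.mixin Record Lmodule_isLieAlgebra (K : fieldType) L of GRing.Lmodule K L := {
  lie : L -> L -> L;
  lieDl : forall x y z, lie (x + y) z = lie x z + lie y z;
  lieDr : forall x y z, lie x (y + z) = lie x y + lie x z;
  lieZl : forall a x y, lie (a *: x) y = a *: lie x y;
  lieZr : forall a x y, lie x (a *: y) = a *: lie x y;
  liexx : forall x, lie x x = 0;
  lie_jacobi : forall x y z,
    lie x (lie y z) + lie y (lie z x) + lie z (lie x y) = 0
}.

#[short(type="lieAlgType")]
HB.structure Definition LieAlgebra (K : fieldType) :=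
  {L of Lmodule_isLieAlgebra K L & GRing.Lmodule K L}.

Definition lie_morphism (K : fieldType) (L L' : lieAlgType K) (f : L -> L') :
    Prop :=
  linear f /\ forall x y, f (lie x y) = lie (f x) (f y).

Inductive lie_term (K : fieldType) (I : Type) : Type :=
| LGen of I
| LZero
| LAdd of lie_term K I & lie_term K I
| LScale of K & lie_term K I
| LBr of lie_term K I & lie_term K I.

Arguments LGen {K I}.
Arguments LZero {K I}.

HB.instance Definition _ (K : fieldType) (I : Type) :=
  gen_eqMixin (lie_term K I).
HB.instance Definition _ (K : fieldType) (I : Type) :=
  gen_choiceMixin (lie_term K I).

Section PresentedLieAlgebra.
Variables (K : fieldType) (I : Type) (R : lie_term K I -> Prop).
Implicit Types t u v w : lie_term K I.

(* The least congruence making the quotient a Lie algebra in which every term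
   satisfying R vanishes. *)
Inductive lie_cong : lie_term K I -> lie_term K I -> Prop :=
| lc_refl t : lie_cong t t
| lc_sym t u : lie_cong t u -> lie_cong u t
| lc_trans t u v : lie_cong t u -> lie_cong u v -> lie_cong t v
| lc_add t t' u u' : lie_cong t t' -> lie_cong u u' ->
    lie_cong (LAdd t u) (LAdd t' u')
| lc_scale a t t' : lie_cong t t' -> lie_cong (LScale a t) (LScale a t')
| lc_br t t' u u' : lie_cong t t' -> lie_cong u u' ->
    lie_cong (LBr t u) (LBr t' u')
| lc_addA t u v : lie_cong (LAdd t (LAdd u v)) (LAdd (LAdd t u) v)
| lc_addC t u : lie_cong (LAdd t u) (LAdd u t)
| lc_add0 t : lie_cong (LAdd LZero t) t
| lc_addN t : lie_cong (LAdd (LScale (-1) t) t) LZero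
| lc_scaleA a b t : lie_cong (LScale a (LScale b t)) (LScale (a * b) t)
| lc_scale1 t : lie_cong (LScale 1 t) t
| lc_scaleDr a t u :
    lie_cong (LScale a (LAdd t u)) (LAdd (LScale a t) (LScale a u))
| lc_scaleDl a b t :
    lie_cong (LScale (a + b) t) (LAdd (LScale a t) (LScale b t))
| lc_brDl t u v : lie_cong (LBr (LAdd t u) v) (LAdd (LBr t v) (LBr u v))
| lc_brDr t u v : lie_cong (LBr t (LAdd u v)) (LAdd (LBr t u) (LBr t v))
| lc_brZl a t u : lie_cong (LBr (LScale a t) u) (LScale a (LBr t u))
| lc_brZr a t u : lie_cong (LBr t (LScale a u)) (LScale a (LBr t u))
| lc_brtt t : lie_cong (LBr t t) LZero
| lc_jacobi t u v :
    lie_cong (LAdd (LAdd (LBr t (LBr u v)) (LBr u (LBr v t)))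
                   (LBr v (LBr t u))) LZero
| lc_rel t : R t -> lie_cong t LZero.

Definition lie_equiv : rel (lie_term K I) := fun t u => `[< lie_cong t u >].

Lemma lie_equiv_refl : reflexive lie_equiv.
Proof. by move=> t; apply/asboolP/lc_refl. Qed.

Lemma lie_equiv_sym : symmetric lie_equiv.
Proof. by move=> t u; apply/asboolP/asboolP => /lc_sym. Qed.

Lemma lie_equiv_trans : transitive lie_equiv.
Proof.
move=> u t v /asboolP tu /asboolP uv.
by apply/asboolP/(lc_trans tu uv).
Qed.

Canonical lie_equiv_rel :=
  EquivRel lie_equiv lie_equiv_refl lie_equiv_sym lie_equiv_trans.

Definition pres_lie : Type := {eq_quot lie_equiv}.
HB.instance Definition _ := Choice.on pres_lie.
HB.instance Definition _ := EqQuotient.on pres_lie.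

Definition lie_class (t : lie_term K I) : pres_lie := \pi_pres_lie t.

Lemma lie_classP t u : lie_class t = lie_class u <-> lie_cong t u.
Proof. by split => [/eqmodP/asboolP|tu]; [|apply/eqmodP/asboolP]. Qed.

Lemma repr_lie_class (x : pres_lie) : lie_class (repr x) = x.
Proof. exact: reprK. Qed.

Lemma lie_cong_repr t : lie_cong (repr (lie_class t)) t.
Proof. by apply/lie_classP; rewrite repr_lie_class. Qed.

Definition pl_zero : pres_lie := lie_class LZero.
Definition pl_add (x y : pres_lie) := lie_class (LAdd (repr x) (repr y)).
Definition pl_scale (a : K) (x : pres_lie) := lie_class (LScale a (repr x)).
Definition pl_opp (x : pres_lie) := pl_scale (-1) x.
Definition pl_br (x y : pres_lie) := lie_class (LBr (repr x) (repr y)).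

Lemma lie_class_add t u :
  pl_add (lie_class t) (lie_class u) = lie_class (LAdd t u).
Proof. by apply/lie_classP/lc_add; apply: lie_cong_repr. Qed.

Lemma lie_class_scale a t : pl_scale a (lie_class t) = lie_class (LScale a t).
Proof. by apply/lie_classP/lc_scale/lie_cong_repr. Qed.

Lemma lie_class_br t u :
  pl_br (lie_class t) (lie_class u) = lie_class (LBr t u).
Proof. by apply/lie_classP/lc_br; apply: lie_cong_repr. Qed.

Let classE := (lie_class_add, lie_class_scale, lie_class_br).

Lemma lie_class_ind (P : pres_lie -> Prop) :
  (forall t, P (lie_class t)) -> forall x, P x.
Proof. by move=> Pt x; rewrite -(repr_lie_class x). Qed.

Lemma pl_addA : associative pl_add.
Proof.
elim/lie_class_ind=> t; elim/lie_class_ind=> u; elim/lie_class_ind=> v.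
rewrite !classE; exact/lie_classP/lc_addA.
Qed.

Lemma pl_addC : commutative pl_add.
Proof.
elim/lie_class_ind=> t; elim/lie_class_ind=> u.
rewrite !classE; exact/lie_classP/lc_addC.
Qed.

Lemma pl_add0 : left_id pl_zero pl_add.
Proof.
elim/lie_class_ind=> t; rewrite !classE; exact/lie_classP/lc_add0.
Qed.

Lemma pl_addN : left_inverse pl_zero pl_opp pl_add.
Proof.
elim/lie_class_ind=> t; rewrite /pl_opp !classE; exact/lie_classP/lc_addN.
Qed.

HB.instance Definition _ :=
  GRing.isZmodule.Build pres_lie pl_addA pl_addC pl_add0 pl_addN.

Lemma pl_scaleA a b (x : pres_lie) :
  pl_scale a (pl_scale b x) = pl_scale (a * b) x.
Proof.
elim/lie_class_ind: x => t; rewrite !classE; exact/lie_classP/lc_scaleA.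
Qed.

Lemma pl_scale1 : left_id 1 pl_scale.
Proof.
elim/lie_class_ind=> t; rewrite !classE; exact/lie_classP/lc_scale1.
Qed.

Lemma pl_scaleDr : right_distributive pl_scale +%R.
Proof.
move=> a; elim/lie_class_ind=> t; elim/lie_class_ind=> u.
rewrite /GRing.add /= !classE; exact/lie_classP/lc_scaleDr.
Qed.

Lemma pl_scaleDl (x : pres_lie) : {morph pl_scale^~ x : a b / a + b}.
Proof.
elim/lie_class_ind: x => t a b.
rewrite [RHS]/GRing.add /= !classE; exact/lie_classP/lc_scaleDl.
Qed.

HB.instance Definition _ := GRing.Zmodule_isLmodule.Build K pres_lie
  pl_scaleA pl_scale1 pl_scaleDr pl_scaleDl.

Lemma pl_brDl (x y z : pres_lie) : pl_br (x + y) z = pl_br x z + pl_br y z.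
Proof.
elim/lie_class_ind: x => t; elim/lie_class_ind: y => u.
elim/lie_class_ind: z => v.
rewrite /GRing.add /= !classE; exact/lie_classP/lc_brDl.
Qed.

Lemma pl_brDr (x y z : pres_lie) : pl_br x (y + z) = pl_br x y + pl_br x z.
Proof.
elim/lie_class_ind: x => t; elim/lie_class_ind: y => u.
elim/lie_class_ind: z => v.
rewrite /GRing.add /= !classE; exact/lie_classP/lc_brDr.
Qed.

Lemma pl_brZl a (x y : pres_lie) : pl_br (a *: x) y = a *: pl_br x y.
Proof.
elim/lie_class_ind: x => t; elim/lie_class_ind: y => u.
rewrite /GRing.scale /= !classE; exact/lie_classP/lc_brZl.
Qed.

Lemma pl_brZr a (x y : pres_lie) : pl_br x (a *: y) = a *: pl_br x y.
Proof.
elim/lie_class_ind: x => t; elim/lie_class_ind: y => u.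
rewrite /GRing.scale /= !classE; exact/lie_classP/lc_brZr.
Qed.

Lemma pl_brxx (x : pres_lie) : pl_br x x = 0.
Proof.
elim/lie_class_ind: x => t; rewrite !classE; exact/lie_classP/lc_brtt.
Qed.

Lemma pl_jacobi (x y z : pres_lie) :
  pl_br x (pl_br y z) + pl_br y (pl_br z x) + pl_br z (pl_br x y) = 0.
Proof.
elim/lie_class_ind: x => t; elim/lie_class_ind: y => u.
elim/lie_class_ind: z => v.
rewrite /GRing.add /= !classE; exact/lie_classP/lc_jacobi.
Qed.

HB.instance Definition _ := Lmodule_isLieAlgebra.Build K pres_lie
  pl_brDl pl_brDr pl_brZl pl_brZr pl_brxx pl_jacobi.

End PresentedLieAlgebra.

Definition is_cartan_matrix (I : finType) (A : I -> I -> int) : Prop :=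
  [/\ forall i, A i i = 2,
      forall i j, i != j -> A i j <= 0
    & forall i j, A i j = 0 -> A j i = 0].

(* For a Cartan matrix the products [A i j * A j i], i != j, are nonnegative,
   so that the absolute value only serves to view them as natural numbers. *)
Definition coxeter_of_cartan (I : finType) (A : I -> I -> int) (i j : I) :
    option nat :=
  let p := absz (A i j * A j i) in
  if i == j then Some 1%N
  else if (p <= 1)%N then Some (2 + p)%N
  else if p \in [:: 2; 3]%N then Some (2 * p)%N
  else None.

(* The exponent [1 - A i j] is positive for a Cartan matrix. *)
Inductive serre_rel (K : fieldType) (I : finType) (A : I -> I -> int) :
    lie_term K I -> Prop :=
| serre i j : i != j ->
    serre_rel A (iter (absz (1 - A i j)) (LBr (LGen i)) (LGen j)).

Definition nilp_lie (K : fieldType) (I : finType) (A : I -> I -> int) :=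
  pres_lie (@serre_rel K I A).
HB.instance Definition _ (K : fieldType) (I : finType) (A : I -> I -> int) :=
  LieAlgebra.on (nilp_lie K A).

Definition nilp_gen (K : fieldType) (I : finType) (A : I -> I -> int) (i : I) :
  nilp_lie K A := lie_class (@serre_rel K I A) (LGen i).

(* Main.v *)
Require Import Defs.
From HB Require Import structures.
From mathcomp Require Import all_boot all_order all_algebra.
From mathcomp Require Import boolp zify.

(** If the support of [phi s'_i'] is [{i}] then [phi s'_i' = s_i].  A braid
    relation of length [m'] between [s'_i'] and [s'_j'] is thus carried to one
    between [s_i] and [s_j]; in the Hecke monoid this forces [m_ij <= m'], as
    the capped lengths of alternating words in [i] and [j] show.  Hence [A'] can
    be chosen with [A' i' j' <= A i j], by giving each double or triple bond
    of [M'] the orientation of its image (if any), and the Serre relations of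
    [A'] become consequences of those of [A].  When [i = j] they hold
    because [[e_i, e_i] = 0]. *)

Set Implicit Arguments.
Unset Strict Implicit.
Unset Printing Implicit Defensive.

Import Order.TTheory GRing.Theory Num.Theory.
Local Open Scope ring_scope.

(** * Alternating words and a lower bound for braid lengths in the Hecke monoid *)

Lemma alt_wordS (T : Type) (x y : T) (n : nat) :
  alt_word x y n.+1 = x :: alt_word y x n.
Proof.
rewrite /alt_word /mkseq /= (iotaDl 1 0) -map_comp; congr (_ :: _).
by apply: eq_map => k /=; case: (odd k).
Qed.

Lemma foldr_alt_wordS (T S : Type) (f : T -> S -> S) s (x y : T) (n : nat) :
  foldr f s (alt_word x y n.+1) = f x (foldr f s (alt_word y x n)).
Proof. by rewrite alt_wordS. Qed.

Section BraidLength.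
Variables (I : finType) (i j : I) (k : nat).

Let state := option (I * nat).

Definition cap_state (x : I) (n : nat) : state :=
  if (n <= k)%N then Some (x, n) else None.

(* [Some (x, n)] stands for the alternating word in [i] and [j] of length [n]
   with first letter [x], [None] for all those of length greater than [k]; the
   letters other than [i] and [j] are erased. *)
Definition alt_act (x : I) (s : state) : state :=
  if (x == i) || (x == j) then
    if s is Some (y, n) then
      if (0 < n)%N && (y == x) then cap_state x n else cap_state x n.+1
    else None
  else s.

Lemma alt_act_idem x s : alt_act x (alt_act x s) = alt_act x s.
Proof.
rewrite /alt_act; case xij: ((x == i) || (x == j)) => //.
case: s => [[y n]|] //.
have capK m : (0 < m)%N ->
    alt_act x (cap_state x m) = cap_state x m.
  rewrite /cap_state /alt_act xij => m0; case: ifP => // mk.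
  by rewrite m0 eqxx /cap_state mk.
rewrite /alt_act xij in capK.
by case: (ltnP 0%N n) => n0; case: (y == x) => /=; rewrite capK.
Qed.

(** Only the last letter of the word, which acts first, can be absorbed by the state; every later
    one differs from the current first letter and so adds one to the length. *)
Lemma foldr_alt_act_cap x y b n r : (x == i) || (x == j) ->
  (y == i) || (y == j) -> x != y ->
  match foldr alt_act (Some (b, n)) (alt_word x y r.+1) with
  | Some (z, n') => [/\ z = x, (n.-1 + r.+1 <= n')%N & (n' <= k)%N]
  | None => True
  end.
Proof.
elim: r x y => [|r IH] x y hx hy xy; rewrite foldr_alt_wordS.
  rewrite /alt_act hx; case: ifP => [/andP[n0 _]|_]; rewrite /cap_state;
    by case: ifP => // nk; split=> //; lia.
move: (IH y x hy hx); rewrite eq_sym xy => /(_ isT).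
case: foldr => [[z n']|]; last by rewrite /alt_act hx.
case=> -> h1 h2; rewrite /alt_act hx eq_sym (negPf xy) andbF /cap_state.
by case: ifP => // ?; split=> //; lia.
Qed.

Lemma foldr_alt_act_over x y s r : (x == i) || (x == j) ->
  (y == i) || (y == j) -> x != y -> (k < r)%N ->
  foldr alt_act s (alt_word x y r) = None.
Proof.
case: s => [[b n]|].
  case: r => // r hx hy xy kr; have := foldr_alt_act_cap b n r hx hy xy.
  by case: foldr => [[z n']|] // [_ h1 h2]; lia.
move=> + + _ _; elim: r x y => // r IH x y hx hy.
by rewrite foldr_alt_wordS IH // /alt_act hx.
Qed.

(** Both words have at least two letters and so contain [x]; as [y] acts trivially, idempotence of
    [x] collapses each of them. *)
Lemma foldr_alt_act_id x y s r : (forall s, alt_act y s = s) ->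
  foldr alt_act s (alt_word x y r.+2) = alt_act x s /\
  foldr alt_act s (alt_word y x r.+2) = alt_act x s.
Proof.
move=> yid; elim: r => [|r [IH1 IH2]].
  by rewrite !foldr_alt_wordS /= !yid.
rewrite (foldr_alt_wordS _ _ x y r.+2) (foldr_alt_wordS _ _ y x r.+2).
by rewrite IH1 IH2 alt_act_idem yid.
Qed.

Lemma foldr_alt_act_alt x y b r : (x == i) || (x == j) ->
  (y == i) || (y == j) -> x != y -> (r < k)%N ->
  foldr alt_act (Some (b, 0%N)) (alt_word x y r.+1) = Some (x, r.+1).
Proof.
elim: r x y => [|r IH] x y hx hy xy rk; rewrite foldr_alt_wordS.
  by rewrite /alt_act hx /= /cap_state rk.
rewrite IH // ?(ltnW rk) //; last by rewrite eq_sym.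
by rewrite /alt_act hx eq_sym (negPf xy) /cap_state rk.
Qed.

(** This makes the states a representation of the Hecke monoid: a braid relation between [i] and [j]
    is longer than [k], so both sides end in [None]; in any other, one letter acts trivially. *)
Lemma foldr_alt_act_cong (M : I -> I -> option nat) u v s :
  is_coxeter_matrix M -> (forall m, M i j = Some m -> (k < m)%N) ->
  word_cong (hecke_rel M) u v -> foldr alt_act s u = foldr alt_act s v.
Proof.
move=> [Msym _ Mge2] kM uv; elim: uv s => {u v} //.
  by move=> u v w _ IH1 _ IH2 s; rewrite IH1.
move=> p u v q Ruv s; rewrite !foldr_cat; congr (foldr alt_act _ p).
case: Ruv => [x|x y m xy Mxy]; first exact: alt_act_idem.
have {Mge2} := Mge2 _ _ _ xy Mxy; case: m Mxy => [|[|r]] // Mxy _.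
have out z : ((z == i) || (z == j)) = false -> forall t, alt_act z t = t.
  by move=> zij t; rewrite /alt_act zij.
have [hx|/negbTE/out hx] := boolP ((x == i) || (x == j)); last first.
  by have [-> ->] := foldr_alt_act_id y (foldr alt_act s q) r hx.
have [hy|/negbTE/out hy] := boolP ((y == i) || (y == j)); last first.
  by have [-> ->] := foldr_alt_act_id x (foldr alt_act s q) r hy.
have km : (k < r.+2)%N.
  apply: kM; case/orP: hx => /eqP xE; case/orP: hy => /eqP yE; subst x y.
  - by rewrite eqxx in xy.
  - by [].
  - by rewrite Msym.
  - by rewrite eqxx in xy.
by rewrite !foldr_alt_act_over // eq_sym.
Qed.

End BraidLength.

Lemma hecke_braid_le (I : finType) (M : I -> I -> option nat) i j k :
  is_coxeter_matrix M -> i != j -> (0 < k)%N ->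
  hecke_word M (alt_word i j k) = hecke_word M (alt_word j i k) ->
  exists2 m, M i j = Some m & (m <= k)%N.
Proof.
move=> cM ij k0 /pres_wordP br.
suff nkM : ~ (forall m, M i j = Some m -> (k < m)%N).
  case Mij: (M i j) nkM => [m|] nkM; last by case: nkM.
  by exists m => //; rewrite leqNgt; apply/negP => km; apply: nkM => _ [<-].
(* Length 0 encodes the empty word, whose recorded letter is a dummy. The two words of length [k]
   lead to states with different first letters. *)
move=> kM; have := foldr_alt_act_cong (Some (i, 0%N)) cM kM br.
case: k k0 {br kM} => // k _.
rewrite !foldr_alt_act_alt ?eqxx ?orbT // 1?eq_sym //.
by case=> /eqP; rewrite (negPf ij).
Qed.

(** * Supports and images of braid relations *)

(** A reduced word using only the letter [i] has length at most 1, because [i i] cancels in the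
    Coxeter group. *)
Lemma supp_set1 (I : finType) (M : I -> I -> option nat)
    (w : hecke_monoid M) i :
  supp w = [set i] -> w = hecke_gen M i.
Proof.
move=> sw; have : i \in supp w by rewrite sw set11.
rewrite inE => /asboolP[u [ured uw iu]].
have ui x : x \in u -> x = i.
  move=> xu; apply/set1P; rewrite -sw inE; apply/asboolP.
  by exists u.
rewrite -uw; case: u => [|x [|y r]] // in ured uw iu ui *.
  by rewrite (ui x) // mem_head.
have xi : x = i by apply: ui; rewrite mem_head.
have yi : y = i by apply: ui; rewrite !inE eqxx orbT.
have : coxeter_word M r = coxeter_word M [:: x, y & r].
  apply/pres_wordP/wc_sym; rewrite xi yi.
  exact: (wc_rel [::] r (cox_invol M i)).
by move/ured => /=; lia.
Qed.

Lemma hecke_morphism_word (I I' : finType) (M : I -> I -> option nat)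
    (M' : I' -> I' -> option nat) (phi : hecke_monoid M' -> hecke_monoid M)
    (h : I' -> I) (w : seq I') :
  monoid.monoid_morphism phi ->
  {in w, forall x, phi (hecke_gen M' x) = hecke_gen M (h x)} ->
  phi (hecke_word M' w) = hecke_word M (map h w).
Proof.
move=> [phi1 phiM]; elim: w => [|x w IH] hw; first exact: phi1.
have wcons (J : finType) (N : J -> J -> option nat) y v :
    hecke_word N (y :: v) = (hecke_gen N y * hecke_word N v)%g.
  exact: (pres_word_cat (hecke_rel N) [:: y] v).
rewrite [map h _]/= !wcons phiM hw ?mem_head // IH //.
by move=> y yw; apply: hw; rewrite inE yw orbT.
Qed.

Lemma map_alt_word (T U : Type) (h : T -> U) x y n :
  map h (alt_word x y n) = alt_word (h x) (h y) n.
Proof. by elim: n x y => // n IH x y; rewrite !alt_wordS /= IH. Qed.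

Lemma mem_alt_word (T : eqType) (x y z : T) n :
  z \in alt_word x y n -> (z == x) || (z == y).
Proof.
elim: n x y => // n IH x y; rewrite alt_wordS inE => /orP[->//|/IH].
by rewrite orbC.
Qed.

Lemma hecke_morphism_braid (I I' : finType) (M : I -> I -> option nat)
    (M' : I' -> I' -> option nat) (phi : hecke_monoid M' -> hecke_monoid M)
    i' j' i j m :
  is_coxeter_matrix M -> is_coxeter_matrix M' -> monoid.monoid_morphism phi ->
  phi (hecke_gen M' i') = hecke_gen M i ->
  phi (hecke_gen M' j') = hecke_gen M j ->
  i' != j' -> i != j -> M' i' j' = Some m ->
  exists2 n, M i j = Some n & (n <= m)%N.
Proof.
move=> cM [_ _ M'ge2] phiP phii phij ij' ij M'ij.
have m0 : (0 < m)%N by apply: leq_trans (M'ge2 _ _ _ ij' M'ij).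
(* Only the values at [i'] and [j'] matter; elsewhere [j] is a default. *)
pose h x := if x == i' then i else j.
have hi : h i' = i by rewrite /h eqxx.
have hj : h j' = j by rewrite /h eq_sym (negPf ij').
have phih x : (x == i') || (x == j') ->
    phi (hecke_gen M' x) = hecke_gen M (h x).
  by case/orP => /eqP ->; rewrite ?hi ?hj.
have phialt x y : (x == i') || (x == j') -> (y == i') || (y == j') ->
    phi (hecke_word M' (alt_word x y m)) =
    hecke_word M (alt_word (h x) (h y) m).
  move=> hx hy; rewrite (hecke_morphism_word (h := h) phiP) ?map_alt_word //.
  by move=> z /mem_alt_word /orP[] /eqP ->; apply: phih.
apply: hecke_braid_le => //.
rewrite -hi -hj -!phialt ?eqxx ?orbT //; congr phi.
apply/pres_wordP; have := wc_rel [::] [::] (hecke_braid ij' M'ij).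
by rewrite /= !cats0.
Qed.

(** * Universal property of presented Lie algebras and iterated brackets *)

Section PresentedLieAlgebraMorphism.
Variables (K : fieldType) (I : Type) (L : lieAlgType K).

Fixpoint lie_eval (g : I -> L) (t : lie_term K I) : L :=
  match t with
  | LGen i => g i
  | LZero => 0
  | LAdd t u => lie_eval g t + lie_eval g u
  | LScale a t => a *: lie_eval g t
  | LBr t u => lie (lie_eval g t) (lie_eval g u)
  end.

Lemma lie_eval_cong (R : lie_term K I -> Prop) g t u :
  (forall t, R t -> lie_eval g t = 0) ->
  lie_cong R t u -> lie_eval g t = lie_eval g u.
Proof.
move=> gR; elim=> {t u} //=.
- by move=> t u v _ -> _ ->.
- by move=> t t' u u' _ -> _ ->.
- by move=> a t t' _ ->.
- by move=> t t' u u' _ -> _ ->.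
- by move=> *; rewrite addrA.
- by move=> *; rewrite addrC.
- by move=> *; rewrite add0r.
- by move=> *; rewrite scaleN1r addNr.
- by move=> *; rewrite scalerA.
- by move=> *; rewrite scale1r.
- by move=> *; rewrite scalerDr.
- by move=> *; rewrite scalerDl.
- by move=> *; rewrite lieDl.
- by move=> *; rewrite lieDr.
- by move=> *; rewrite lieZl.
- by move=> *; rewrite lieZr.
- by move=> *; rewrite liexx.
- by move=> *; rewrite lie_jacobi.
Qed.

Lemma pres_lie_morphism (R : lie_term K I -> Prop) (g : I -> L) :
  (forall t, R t -> lie_eval g t = 0) ->
  exists F : pres_lie R -> L,
    lie_morphism F /\ forall i, F (lie_class R (LGen i)) = g i.
Proof.
move=> gR; pose F (x : pres_lie R) := lie_eval g (repr x).
have FE t : F (lie_class R t) = lie_eval g t.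
  exact: lie_eval_cong gR (lie_cong_repr R t).
exists F; split; last by move=> i; rewrite FE.
split=> [a|].
  elim/lie_class_ind=> t; elim/lie_class_ind=> u.
  have -> : a *: lie_class R t + lie_class R u =
      lie_class R (LAdd (LScale a t) u).
    by rewrite -lie_class_add -lie_class_scale.
  by rewrite !FE.
elim/lie_class_ind=> t; elim/lie_class_ind=> u.
have -> : lie (lie_class R t) (lie_class R u) = lie_class R (LBr t u).
  exact: lie_class_br.
by rewrite !FE.
Qed.

Lemma lie_eval_iter g t u n :
  lie_eval g (iter n (LBr t) u) =
  iter n (lie (lie_eval g t)) (lie_eval g u).
Proof. by elim: n => //= n ->. Qed.

End PresentedLieAlgebraMorphism.

Section LieIter.
Variables (K : fieldType) (L : lieAlgType K).
Implicit Types x y : L.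

Lemma liex0 x : lie x 0 = 0.
Proof. by rewrite -(scale0r (0 : L)) lieZr !scale0r. Qed.

Lemma lie0x x : lie 0 x = 0.
Proof. by rewrite -(scale0r (0 : L)) lieZl !scale0r. Qed.

Lemma iter_lie0 x n : iter n (lie x) 0 = 0.
Proof. by elim: n => //= n ->; rewrite liex0. Qed.

Lemma iter_lie_le x y m n :
  (m <= n)%N -> iter m (lie x) y = 0 -> iter n (lie x) y = 0.
Proof. by move=> /subnK <- xy0; rewrite iterD xy0 iter_lie0. Qed.

End LieIter.

Lemma nilp_serre (K : fieldType) (I : finType) (A : I -> I -> int) i j :
  i != j ->
  iter (absz (1 - A i j)) (lie (nilp_gen K A i)) (nilp_gen K A j) = 0.
Proof.
move=> ij; pose R := @serre_rel K I A.
have iterE n : iter n (lie (nilp_gen K A i)) (nilp_gen K A j) =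
    lie_class R (iter n (LBr (LGen i)) (LGen j)).
  by elim: n => //= n ->; apply: lie_class_br.
by rewrite iterE; apply/lie_classP/lc_rel/serre.
Qed.

(** * Lifting a Weyl-type Coxeter matrix to a Cartan matrix *)

Section CartanLift.
Variables (I : finType) (M : I -> I -> option nat) (a : I -> I -> int).
Hypotheses (cM : is_coxeter_matrix M) (wM : weyl_type M).

(** Decides whether the -2 or -3 of a double or triple bond sits at [(i, j)] or at [(j, i)]. *)
Definition long_bond (i j : I) : bool :=
  (a i j < a j i) || (a i j == a j i) && (enum_rank i < enum_rank j)%N.

Lemma long_bondC i j : i != j -> long_bond i j = ~~ long_bond j i.
Proof.
move=> ij; rewrite /long_bond.
have : nat_of_ord (enum_rank i) != enum_rank j.
  by apply: contra ij => /eqP /val_inj /enum_rank_inj ->.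
by lia.
Qed.

(* Double and triple bonds are oriented as prescribed by [a], ties being broken
   by the enumeration of [I]. *)
Definition cartan_lift (i j : I) : int :=
  if i == j then 2 else
  match M i j with
  | Some 2 => 0
  | Some 3 => -1
  | Some 4 => if long_bond i j then -2 else -1
  | Some 6 => if long_bond i j then -3 else -1
  | _ => - (2 + `|a i j|)
  end.

Lemma cartan_lift_cartan : is_cartan_matrix cartan_lift.
Proof.
case: cM => Msym _ _; rewrite /cartan_lift; split=> [i|i j ij|i j].
- by rewrite eqxx.
- rewrite (negPf ij); have := wM ij; rewrite !inE.
  by do 4![case/orP=> [/eqP->|]; first by [|case: ifP]]; move=> /eqP ->; lia.
- rewrite (eq_sym j i) (Msym j i); case: eqVneq => // ij.
  have := wM ij; rewrite !inE.
  by do 4![case/orP=> [/eqP->|]; first by [|case: ifP]]; move=> /eqP ->; lia.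
Qed.

Lemma cartan_lift_coxeter : M =2 coxeter_of_cartan cartan_lift.
Proof.
case: cM => Msym M1 _ i j; rewrite /coxeter_of_cartan /cartan_lift.
rewrite (eq_sym j i) (Msym j i).
case: eqVneq => [->|ij]; first by rewrite M1.
rewrite (long_bondC ij).
have := wM ij; rewrite !inE.
do 4![case/orP=> [/eqP->|]; first by [|case: long_bond]].
move=> /eqP ->.
(* At an infinite bond both entries are at most -2, so their product is at least 4. *)
set p := absz _; have p3 : (3 < p)%N by rewrite /p; nia.
by case: p p3 => [|[|[|[|p]]]].
Qed.

(** For a finite bond the bound limits the product of the two entries of [a]. If they are nonzero, a
    product at most 3 forces the one of smaller absolute value to be -1, and the orientation puts
    the -2 or -3 at the other. *)
Lemma cartan_lift_le i j :
  i != j -> a i j <= 0 -> a j i <= 0 -> (a i j == 0) = (a j i == 0) ->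
  (forall m', M i j = Some m' -> exists2 n,
     coxeter_of_cartan a i j = Some n & (n <= m')%N) ->
  cartan_lift i j <= a i j.
Proof.
move=> ij aij aji a0 bound; rewrite /cartan_lift (negPf ij).
case Mij: (M i j) => [m|]; last by lia.
have [n] := bound m Mij.
rewrite /coxeter_of_cartan (negPf ij) /long_bond; set p := absz _.
have pE : p%:Z = a i j * a j i by rewrite /p; nia.
move=> np nm.
have [p3 pm] : (p <= 3)%N /\ ((p <= 1)%N /\ (2 + p <= m)%N \/
    (2 <= p)%N /\ (2 * p <= m)%N).
  move: np; case: ifP => [p1 [pn]|p1]; first by lia.
  by case: ifP => // p23 [pn]; move: p23; rewrite !inE; lia.
(* Every branch of the lift is nonpositive, which settles a zero entry. *)
have [x0|x0] := eqVneq (a i j) 0.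
  by case: m {Mij nm pm} => [|[|[|[|[|[|[|m]]]]]]]; try case: ifP; lia.
have y0 : a j i <= -1 by lia.
have {x0}x0 : a i j <= -1 by lia.
have := wM ij; rewrite Mij !inE orbF => /or4P[] /eqP[mE]; subst m.
- nia.
- nia.
- have {p3 pm}p2 : (p <= 2)%N by lia.
  by case: ifP; nia.
- by case: ifP; nia.
Qed.

End CartanLift.

(** * Construction of the Cartan matrix and the Lie algebra homomorphism *)

Theorem theorem4p38 (K : fieldType) (I I' : finType)
    (M : I -> I -> option nat) (M' : I' -> I' -> option nat)
    (hM : is_coxeter_matrix M) (hMW : weyl_type M)
    (hM' : is_coxeter_matrix M') (hMW' : weyl_type M')
    (phi : hecke_monoid M' -> hecke_monoid M)
    (hphi : monoid.monoid_morphism phi) (hlight : light phi)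
    (A : I -> I -> int) (hA : is_cartan_matrix A)
    (hMA : M =2 coxeter_of_cartan A) :
  exists A' : I' -> I' -> int,
    [/\ is_cartan_matrix A',
        M' =2 coxeter_of_cartan A'
      & exists F : nilp_lie K A' -> nilp_lie K A,
          lie_morphism F /\
          forall i' : I',
            (forall i : I, gen_supp phi i' = [set i] ->
               F (nilp_gen K A' i') = nilp_gen K A i) /\
            (gen_supp phi i' = set0 -> F (nilp_gen K A' i') = 0)].
Proof.
pose g i' := [pick i in gen_supp phi i'].
(* By lightness the chosen element is the whole support. *)
have gP i' i : g i' = Some i -> phi (hecke_gen M' i') = hecke_gen M i.
  rewrite /g; case: pickP => // x xi [<-]; apply: supp_set1.
  by apply/eqP; rewrite eq_sym eqEcard sub1set xi cards1; apply: hlight.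
(* The pullback of [A] along [g]; the 0 for generators sent to 1 is a default, since the lift is a
   Cartan matrix whatever [a] is. *)
pose a i' j' := if (g i', g j') is (Some i, Some j) then A i j else 0.
pose e i' := if g i' is Some i then nilp_gen K A i else 0.
have cA' := cartan_lift_cartan a hM' hMW'.
exists (cartan_lift M' a); split=> //; first exact: cartan_lift_coxeter.
suff serre0 t : serre_rel (cartan_lift M' a) t -> lie_eval e t = 0.
  have [F [Fm Fe]] := pres_lie_morphism serre0.
  exists F; split=> // i'; split=> [i si|s0]; rewrite Fe /e /g.
    case: pickP => [x|/(_ i)]; rewrite si inE; first by move/eqP ->.
    by rewrite eqxx.
  by case: pickP => // x; rewrite s0 inE.
case=> i' j' ij'; rewrite lie_eval_iter /=.
have [_ /(_ _ _ ij') neg _] := cA'.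
(* The exponent is at least 1, so one vanishing bracket suffices in the degenerate cases. *)
set n := absz _; have n0 : (0 < n)%N by rewrite /n; lia.
rewrite /e; case gi: (g i') => [i|]; case gj: (g j') => [j|].
- case: (eqVneq i j) => [->|ij].
    by apply: (iter_lie_le n0); rewrite /= liexx.
  apply: iter_lie_le (nilp_serre K A ij).
  have aij : a i' j' = A i j by rewrite /a gi gj.
  have aji : a j' i' = A j i by rewrite /a gi gj.
  have [_ Aneg A0] := hA.
  (* As [A i j] is nonpositive, a smaller entry means a larger Serre exponent. *)
  suff : cartan_lift M' a i' j' <= A i j by have := Aneg _ _ ij; lia.
  rewrite -aij; apply: cartan_lift_le => //; rewrite ?aij ?aji ?Aneg //.
  + by rewrite eq_sym.
  + by apply/eqP/eqP => /A0.
  + move=> m M'm.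
    have [k Mk km] := hecke_morphism_braid hM hM' hphi (gP _ _ gi) (gP _ _ gj)
      ij' ij M'm.
    exists k => //; rewrite -Mk hMA /coxeter_of_cartan aij aji.
    by rewrite (negPf ij) (negPf ij').
- by rewrite iter_lie0.
- by apply: (iter_lie_le n0); rewrite /= lie0x.
- by rewrite iter_lie0.
Qed.
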